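(* Let $\mathbb A$ be a distributive monoidal category, with free cornering with iteration $\ulcorner\mathbb A\urcorner^{*}$ and crossing cells $\chi_{U,A}:(U;A;A;U)$ in it. For all $U\in\mathbb A^{\circ\bullet}_*$ and $A,B\in\mathbb A_0$: (i) $\chi_{U,A\otimes B}=\chi_{U,A}\mid\chi_{U,B}$; (ii) $\chi_{U,I}=id_U$.
   Context: Monoidal categories are strict, and composites are in diagrammatic order ($fg$ is first $f$, then $g$). $\sigma_{A,B}:A\otimes B\to B\otimes A$ is the braiding. A single-object double category $\mathbb D$ has a horizontal edge monoid $(\mathbb D_H,\otimes,I)$, a vertical edge monoid $(\mathbb D_V,\otimes,I)$, and for $A,B\in\mathbb D_H$, $U,W\in\mathbb D_V$ a set of cells $(U;A;B;W)$ (left; top; bottom; right boundary). For $\alpha:(U;A;B;V)$ and $\beta:(V;A';B';W)$ there is a horizontal composite $\alpha\mid\beta:(U;A\otimes A';B\otimes B';W)$; for $\alpha:(U;A;C;W)$ and $\beta:(U';C;B;W')$ a vertical composite $\frac{\alpha}{\beta}:(U\otimes U';A;B;W\otimes W')$. Both are associative and unital, with horizontal units $id_U:(U;I;I;U)$ and vertical units $1_A:(I;A;A;I)$, where $id_I=1_I$, $1_{A\otimes B}=1_A\mid 1_B$, $id_{U\otimes W}=\frac{id_U}{id_W}$, and interchange $\frac{\alpha}{\beta}\mid\frac{\gamma}{\delta}=\frac{\alpha\mid\gamma}{\beta\mid\delta}$ holds. A distributive monoidal category $(\mathbb A,\otimes,\oplus,I)$ is a symmetric monoidal category with binary coproducts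 $A\oplus B$ (injections $\sigma_0,\sigma_1$, copairing $[f,g]$; no initial object required) such that $[\sigma_0\otimes 1_C,\sigma_1\otimes 1_C]:(A\otimes C)\oplus(B\otimes C)\to(A\oplus B)\otimes C$ is invertible for all $A,B,C$. Exchanges with iteration: $\mathbb A^{\circ\bullet}_*$ is the monoid (operation $\otimes$, unit $I$) with elements generated by $A^\circ$, $A^\bullet$ ($A\in\mathbb A_0$), $I$, $U\otimes W$, $U\times W$, $U+W$, $U^\times$, $U^+$, subject to associativity and unitality of $\otimes$ and the equations $U^\times=I\times(U\otimes U^\times)$, $U^+=I+(U\otimes U^+)$. Free cornering with iteration: $\ulcorner\mathbb A\urcorner^{*}$ is the free single-object double category with horizontal edge monoid $(\mathbb A_0,\otimes,I)$, vertical edge monoid $\mathbb A^{\circ\bullet}_*$, and generating cells and equations: (1) for each $f:A\to B$ in $\mathbb A$ a cell $\ulcorner f\urcorner:(I;A;B;I)$ (also written $f$), with $\ulcorner fg\urcorner=\frac{\ulcorner f\urcorner}{\ulcorner g\urcorner}$, $\ulcorner 1_A\urcorner=1_A$, $\ulcorner f\otimes g\urcorner=\ulcorner f\urcorner\mid\ulcorner g\urcorner$; (2) for each $A\in\mathbb A_0$ corner cells $\mathsf{get}_L^A:(A^\circ;I;A;I)$, $\mathsf{put}_R^A:(I;A;I;A^\circ)$, $\mathsf{get}_R^A:(I;I;A;A^\bullet)$, $\mathsf{put}_L^A:(A^\bullet;A;I;I)$ with $\mathsf{put}_R^A\mid\mathsf{get}_L^A=1_A$, $\frac{\mathsf{get}_L^A}{\mathsf{put}_R^A}=id_{A^\circ}$,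 $\mathsf{get}_R^A\mid\mathsf{put}_L^A=1_A$, $\frac{\mathsf{get}_R^A}{\mathsf{put}_L^A}=id_{A^\bullet}$; (3) for all $U,W$, cells $\pi_0:(U\times W;I;I;U)$, $\pi_1:(U\times W;I;I;W)$, and for $\alpha:(V;A;B;U)$, $\beta:(V;A;B;W)$ a unique cell $\alpha\times\beta:(V;A;B;U\times W)$ with $(\alpha\times\beta)\mid\pi_0=\alpha$, $(\alpha\times\beta)\mid\pi_1=\beta$; (4) for all $U,W$, cells $\iota_0:(U;I;I;U+W)$, $\iota_1:(W;I;I;U+W)$, and for $\alpha:(U;A;B;V)$, $\beta:(W;A;B;V)$ a unique cell $\alpha+\beta:(U+W;A;B;V)$ with $\iota_0\mid(\alpha+\beta)=\alpha$, $\iota_1\mid(\alpha+\beta)=\beta$; (5) for $\alpha:(U;A;C;W)$, $\beta:(U;B;C;W)$ a unique cell $[\alpha,\beta]:(U;A\oplus B;C;W)$ with $\frac{\ulcorner\sigma_0\urcorner}{[\alpha,\beta]}=\alpha$, $\frac{\ulcorner\sigma_1\urcorner}{[\alpha,\beta]}=\beta$; (6) for $\alpha:(V;A;A;U)$, $f:(W;A;B;K)$, $g:(W;I;I;V\otimes W)$ a unique cell $\alpha^\times_{f,g}:(W;A;B;U^\times\otimes K)$ with $\alpha^\times_{f,g}\mid\frac{\pi_0}{id_K}=f$ and $\alpha^\times_{f,g}\mid\frac{\pi_1}{id_K}=g\mid\frac{\alpha}{\alpha^\times_{f,g}}$; (7) for $\alpha:(U;A;A;V)$, $f:(K;A;B;W)$,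 $g:(V\otimes W;I;I;W)$ a unique cell $\alpha^+_{f,g}:(U^+\otimes K;A;B;W)$ with $\frac{\iota_0}{id_K}\mid\alpha^+_{f,g}=f$ and $\frac{\iota_1}{id_K}\mid\alpha^+_{f,g}=\frac{\alpha}{\alpha^+_{f,g}}\mid g$. Here $\pi_0:U^\times\to I$, $\pi_1:U^\times\to U\otimes U^\times$, $\iota_0:I\to U^+$, $\iota_1:U\otimes U^+\to U^+$ are the projections/injections of $U^\times=I\times(U\otimes U^\times)$ and $U^+=I+(U\otimes U^+)$. For $\alpha:(U;A;A;W)$ put $\alpha^\times=\alpha^\times_{(\pi_0\mid 1_A),\pi_1}:(U^\times;A;A;W^\times)$ and $\alpha^+=\alpha^+_{(1_A\mid\iota_0),\iota_1}:(U^+;A;A;W^+)$. Crossing cells $\chi_{U,B}:(U;B;B;U)$, by induction on $U$: $\chi_{A^\circ,B}$ is the vertical composite (top to bottom) of $\mathsf{get}_L^A\mid 1_B$, $\sigma_{A,B}$, $1_B\mid\mathsf{put}_R^A$; $\chi_{A^\bullet,B}$ is the vertical composite (top to bottom) of $1_B\mid\mathsf{get}_R^A$, $\sigma_{B,A}$, $\mathsf{put}_L^A\mid 1_B$; $\chi_{I,B}=1_B$; $\chi_{U\otimes W,B}=\frac{\chi_{U,B}}{\chi_{W,B}}$; $\chi_{U+W,B}=(\chi_{U,B}\mid\iota_0)+(\chi_{W,B}\mid\iota_1)$; $\chi_{U\times W,B}=(\pi_0\mid\chi_{U,B})\times(\pi_1\mid\chi_{W,B})$; $\chi_{U^\times,B}=(\chi_{U,B})^\times$;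 $\chi_{U^+,B}=(\chi_{U,B})^+$. *)

(* Defs.v *)
From mathcomp Require Import ssreflect ssrfun ssrbool.

Set Implicit Arguments.
Unset Strict Implicit.
Unset Printing Implicit Defensive.

Declare Scope obj_scope.
Declare Scope exch_scope.
Declare Scope cell_scope.

Reserved Notation "X ⊗ Y" (at level 40, left associativity).
Reserved Notation "X ⊕ Y" (at level 50, left associativity).
Reserved Notation "f ;; g" (at level 60, right associativity).
Reserved Notation "U × W" (at level 45, no associativity).
Reserved Notation "U ∔ W" (at level 50, no associativity).
Reserved Notation "U ^×" (at level 1, left associativity).
Reserved Notation "U ^∔" (at level 1, left associativity).
Reserved Notation "U ≈ W" (at level 70, no associativity).
Reserved Notation "x ≡ y" (at level 70, no associativity).
Reserved Notation "x <|> y" (at level 54, left associativity).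
Reserved Notation "x </> y" (at level 53, left associativity).

Definition transport2 (T : Type) (H : T -> T -> Type) (A A' B B' : T)
    (eA : A = A') (eB : B = B') (f : H A B) : H A' B' :=
  match eA in _ = X, eB in _ = Y return H X Y with
  | erefl, erefl => f
  end.

(* Composition [comp f g] is in diagrammatic order: first [f], then [g]. The
   tensor is strict: its laws on objects are equalities, and those on morphisms
   hold up to transport along them. *)
Record smcat := SMCat {
  ob :> Type;
  hom : ob -> ob -> Type;
  idm : forall A, hom A A;
  comp : forall A B C, hom A B -> hom B C -> hom A C;
  comp_idl : forall A B (f : hom A B), comp (idm A) f = f;
  comp_idr : forall A B (f : hom A B), comp f (idm B) = f;
  comp_assoc : forall A B C D (f : hom A B) (g : hom B C) (h : hom C D),
    comp f (comp g h) = comp (comp f g) h;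
  unit_ob : ob;
  tens : ob -> ob -> ob;
  tens_assoc : forall A B C, tens A (tens B C) = tens (tens A B) C;
  tens_unitl : forall A, tens unit_ob A = A;
  tens_unitr : forall A, tens A unit_ob = A;
  tensm : forall A B C D, hom A B -> hom C D -> hom (tens A C) (tens B D);
  tensm_id : forall A B, tensm (idm A) (idm B) = idm (tens A B);
  tensm_comp : forall A B C A' B' C'
      (f : hom A B) (g : hom B C) (f' : hom A' B') (g' : hom B' C'),
    tensm (comp f g) (comp f' g') = comp (tensm f f') (tensm g g');
  tensm_assoc : forall A B A' B' A'' B''
      (f : hom A B) (f' : hom A' B') (f'' : hom A'' B''),
    transport2 (tens_assoc A A' A'') (tens_assoc B B' B'')
      (tensm f (tensm f' f'')) = tensm (tensm f f') f'';
  tensm_unitl : forall A B (f : hom A B),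
    transport2 (tens_unitl A) (tens_unitl B) (tensm (idm unit_ob) f) = f;
  tensm_unitr : forall A B (f : hom A B),
    transport2 (tens_unitr A) (tens_unitr B) (tensm f (idm unit_ob)) = f;
  braid : forall A B, hom (tens A B) (tens B A);
  braid_natural : forall A B A' B' (f : hom A B) (f' : hom A' B'),
    comp (tensm f f') (braid B B') = comp (braid A A') (tensm f' f);
  braid_sym : forall A B, comp (braid A B) (braid B A) = idm (tens A B);
  braid_hexagon : forall A B C,
    transport2 (tens_assoc A B C) erefl (braid A (tens B C)) =
    comp (tensm (braid A B) (idm C))
         (transport2 (tens_assoc B A C) (tens_assoc B C A)
            (tensm (idm B) (braid A C)))
}.

Arguments unit_ob {s}.
Arguments idm {s} A.
Arguments braid {s} A B.

Notation "X ⊗ Y" := (tens X Y) : obj_scope.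
Notation "f ;; g" := (comp f g) : obj_scope.
Bind Scope obj_scope with ob.
Delimit Scope obj_scope with obj.

Definition is_iso (C : smcat) (A B : C) (f : hom A B) : Prop :=
  exists g : hom B A, comp f g = idm A /\ comp g f = idm B.

Record dmcat := DMCat {
  smcat_of :> smcat;
  osum : smcat_of -> smcat_of -> smcat_of;
  inj0 : forall A B, hom A (osum A B);
  inj1 : forall A B, hom B (osum A B);
  copair : forall A B C, hom A C -> hom B C -> hom (osum A B) C;
  copair_inj0 : forall A B C (f : hom A C) (g : hom B C),
    comp (inj0 A B) (copair f g) = f;
  copair_inj1 : forall A B C (f : hom A C) (g : hom B C),
    comp (inj1 A B) (copair f g) = g;
  copair_unique : forall A B C (f : hom A C) (g : hom B C)
      (h : hom (osum A B) C),
    comp (inj0 A B) h = f -> comp (inj1 A B) h = g -> h = copair f g;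
  distributive : forall A B C,
    is_iso (copair (tensm (inj0 A B) (idm C)) (tensm (inj1 A B) (idm C)))
}.

Arguments inj0 {d} A B.
Arguments inj1 {d} A B.

Notation "X ⊕ Y" := (osum X Y) : obj_scope.

(* The monoid of exchanges is presented by generators and relations: an element
   is represented by an expression of type [exch C], and [U ≈ W] says that [U]
   and [W] represent the same element. *)
Inductive exch (C : dmcat) : Type :=
| ecirc of C
| ebullet of C
| eunit
| etens of exch C & exch C
| etimes of exch C & exch C
| eplus of exch C & exch C
| eitimes of exch C
| eiplus of exch C.

Arguments ecirc {C} A.
Arguments ebullet {C} A.
Arguments eunit {C}.

Notation "U ⊗ W" := (etens U W) : exch_scope.
Notation "U × W" := (etimes U W) : exch_scope.
Notation "U ∔ W" := (eplus U W) : exch_scope.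
Notation "U ^×" := (eitimes U) : exch_scope.
Notation "U ^∔" := (eiplus U) : exch_scope.
Bind Scope exch_scope with exch.
Delimit Scope exch_scope with exch.
Local Open Scope exch_scope.

Inductive exch_eq (C : dmcat) : exch C -> exch C -> Prop :=
| exch_refl U : U ≈ U
| exch_sym U W : U ≈ W -> W ≈ U
| exch_trans U V W : U ≈ V -> V ≈ W -> U ≈ W
| exch_tens_congr U U' W W' : U ≈ U' -> W ≈ W' -> U ⊗ W ≈ U' ⊗ W'
| exch_times_congr U U' W W' : U ≈ U' -> W ≈ W' -> U × W ≈ U' × W'
| exch_plus_congr U U' W W' : U ≈ U' -> W ≈ W' -> U ∔ W ≈ U' ∔ W'
| exch_itimes_congr U U' : U ≈ U' -> U^× ≈ U'^×
| exch_iplus_congr U U' : U ≈ U' -> U^∔ ≈ U'^∔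
| exch_assoc U V W : U ⊗ (V ⊗ W) ≈ (U ⊗ V) ⊗ W
| exch_unitl U : eunit ⊗ U ≈ U
| exch_unitr U : U ⊗ eunit ≈ U
| exch_itimes U : U^× ≈ eunit × (U ⊗ U^×)
| exch_iplus U : U^∔ ≈ eunit ∔ (U ⊗ U^∔)
where "U ≈ W" := (exch_eq U W) : exch_scope.

(* Cells are likewise presented by expressions [cell U A B W], whose boundaries
   are, in order, left, top, bottom, right, modulo the congruence [cell_eq]
   below. Since boundaries matter only up to the equations of the edge monoids,
   [cast] allows a cell to be regarded as having any equal boundary. *)
Inductive cell (C : dmcat) : exch C -> C -> C -> exch C -> Type :=
| cast U A B W U' A' B' W' :
    U ≈ U' -> A = A' -> B = B' -> W ≈ W' -> cell U A B W -> cell U' A' B' W'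
| hid U : cell U unit_ob unit_ob U
| vid A : cell eunit A A eunit
| hcomp U A B V A' B' W :
    cell U A B V -> cell V A' B' W -> cell U (A ⊗ A') (B ⊗ B') W
| vcomp U A X W U' B W' :
    cell U A X W -> cell U' X B W' -> cell (U ⊗ U') A B (W ⊗ W')
| box A B : hom A B -> cell eunit A B eunit
| getL A : cell (ecirc A) unit_ob A eunit
| putR A : cell eunit A unit_ob (ecirc A)
| getR A : cell eunit unit_ob A (ebullet A)
| putL A : cell (ebullet A) A unit_ob eunit
| cproj0 U W : cell (U × W) unit_ob unit_ob U
| cproj1 U W : cell (U × W) unit_ob unit_ob W
| cprod V A B U W : cell V A B U -> cell V A B W -> cell V A B (U × W)
| cinj0 U W : cell U unit_ob unit_ob (U ∔ W)
| cinj1 U W : cell W unit_ob unit_ob (U ∔ W)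
| csum U W A B V : cell U A B V -> cell W A B V -> cell (U ∔ W) A B V
| ccopair U A B X W : cell U A X W -> cell U B X W -> cell U (A ⊕ B) X W
| citimes V A U W B K :
    cell V A A U -> cell W A B K -> cell W unit_ob unit_ob (V ⊗ W) ->
    cell W A B (U^× ⊗ K)
| ciplus U A V K B W :
    cell U A A V -> cell K A B W -> cell (V ⊗ W) unit_ob unit_ob W ->
    cell (U^∔ ⊗ K) A B W.

Arguments cell {C}.
Arguments hid {C} U.
Arguments vid {C} A.
Arguments getL {C} A.
Arguments putR {C} A.
Arguments getR {C} A.
Arguments putL {C} A.
Arguments cproj0 {C} U W.
Arguments cproj1 {C} U W.
Arguments cinj0 {C} U W.
Arguments cinj1 {C} U W.

Bind Scope cell_scope with cell.
Delimit Scope cell_scope with cell.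
Local Open Scope cell_scope.

Notation "x <|> y" := (hcomp x y) : cell_scope.
Notation "x </> y" := (vcomp x y) : cell_scope.

Definition itimes_proj0 (C : dmcat) (U : exch C) :
    cell (U^×) unit_ob unit_ob eunit :=
  cast (exch_sym (exch_itimes U)) erefl erefl (exch_refl _) (cproj0 _ _).

Definition itimes_proj1 (C : dmcat) (U : exch C) :
    cell (U^×) unit_ob unit_ob (U ⊗ U^×) :=
  cast (exch_sym (exch_itimes U)) erefl erefl (exch_refl _) (cproj1 _ _).

Definition iplus_inj0 (C : dmcat) (U : exch C) :
    cell eunit unit_ob unit_ob (U^∔) :=
  cast (exch_refl _) erefl erefl (exch_sym (exch_iplus U)) (cinj0 _ _).

Definition iplus_inj1 (C : dmcat) (U : exch C) :
    cell (U ⊗ U^∔) unit_ob unit_ob (U^∔) :=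
  cast (exch_refl _) erefl erefl (exch_sym (exch_iplus U)) (cinj1 _ _).

(* [cell_eq] is the least congruence satisfying the equations of the free
   cornering with iteration. It is heterogeneous because the two sides of most
   equations have boundaries that agree only up to the equations of the edge
   monoids; only such cells are ever related (see [cell_eq_boundary]). *)
Inductive cell_eq (C : dmcat) : forall (U : exch C) (A B : C) (W : exch C),
    cell U A B W -> forall (U' : exch C) (A' B' : C) (W' : exch C),
    cell U' A' B' W' -> Prop :=
| ceq_refl U A B W (x : cell U A B W) : x ≡ x
| ceq_sym U A B W U' A' B' W' (x : cell U A B W) (y : cell U' A' B' W') :
    x ≡ y -> y ≡ x
| ceq_trans U A B W U' A' B' W' U'' A'' B'' W''
    (x : cell U A B W) (y : cell U' A' B' W') (z : cell U'' A'' B'' W'') :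
    x ≡ y -> y ≡ z -> x ≡ z
| ceq_cast U A B W U' A' B' W' (eU : U ≈ U') (eA : A = A') (eB : B = B')
    (eW : W ≈ W') (x : cell U A B W) :
    cast eU eA eB eW x ≡ x
| ceq_hid U U' : U ≈ U' -> hid U ≡ hid U'
| ceq_hcomp U A B V A' B' W U_ A_ B_ V_ A'_ B'_ W_
    (x : cell U A B V) (y : cell V A' B' W)
    (x_ : cell U_ A_ B_ V_) (y_ : cell V_ A'_ B'_ W_) :
    x ≡ x_ -> y ≡ y_ -> x <|> y ≡ x_ <|> y_
| ceq_vcomp U A X W U' B W' U_ A_ X_ W_ U'_ B_ W'_
    (x : cell U A X W) (y : cell U' X B W')
    (x_ : cell U_ A_ X_ W_) (y_ : cell U'_ X_ B_ W'_) :
    x ≡ x_ -> y ≡ y_ -> x </> y ≡ x_ </> y_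
| ceq_cproj0 U W U' W' : U ≈ U' -> W ≈ W' -> cproj0 U W ≡ cproj0 U' W'
| ceq_cproj1 U W U' W' : U ≈ U' -> W ≈ W' -> cproj1 U W ≡ cproj1 U' W'
| ceq_cprod V A B U W V_ A_ B_ U_ W_
    (x : cell V A B U) (y : cell V A B W)
    (x_ : cell V_ A_ B_ U_) (y_ : cell V_ A_ B_ W_) :
    x ≡ x_ -> y ≡ y_ -> cprod x y ≡ cprod x_ y_
| ceq_cinj0 U W U' W' : U ≈ U' -> W ≈ W' -> cinj0 U W ≡ cinj0 U' W'
| ceq_cinj1 U W U' W' : U ≈ U' -> W ≈ W' -> cinj1 U W ≡ cinj1 U' W'
| ceq_csum U W A B V U_ W_ A_ B_ V_
    (x : cell U A B V) (y : cell W A B V)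
    (x_ : cell U_ A_ B_ V_) (y_ : cell W_ A_ B_ V_) :
    x ≡ x_ -> y ≡ y_ -> csum x y ≡ csum x_ y_
| ceq_ccopair U A B X W U_ A_ B_ X_ W_
    (x : cell U A X W) (y : cell U B X W)
    (x_ : cell U_ A_ X_ W_) (y_ : cell U_ B_ X_ W_) :
    x ≡ x_ -> y ≡ y_ -> ccopair x y ≡ ccopair x_ y_
| ceq_citimes V A U W B K V_ A_ U_ W_ B_ K_
    (x : cell V A A U) (f : cell W A B K)
    (g : cell W unit_ob unit_ob (V ⊗ W))
    (x_ : cell V_ A_ A_ U_) (f_ : cell W_ A_ B_ K_)
    (g_ : cell W_ unit_ob unit_ob (V_ ⊗ W_)) :
    x ≡ x_ -> f ≡ f_ -> g ≡ g_ -> citimes x f g ≡ citimes x_ f_ g_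
| ceq_ciplus U A V K B W U_ A_ V_ K_ B_ W_
    (x : cell U A A V) (f : cell K A B W)
    (g : cell (V ⊗ W) unit_ob unit_ob W)
    (x_ : cell U_ A_ A_ V_) (f_ : cell K_ A_ B_ W_)
    (g_ : cell (V_ ⊗ W_) unit_ob unit_ob W_) :
    x ≡ x_ -> f ≡ f_ -> g ≡ g_ -> ciplus x f g ≡ ciplus x_ f_ g_
| hcomp_assoc U A B V A' B' V' A'' B'' W
    (x : cell U A B V) (y : cell V A' B' V') (z : cell V' A'' B'' W) :
    x <|> (y <|> z) ≡ (x <|> y) <|> z
| hcomp_idl U A B W (x : cell U A B W) : hid U <|> x ≡ x
| hcomp_idr U A B W (x : cell U A B W) : x <|> hid W ≡ x
| vcomp_assoc U A X W U' Y W' U'' B W''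
    (x : cell U A X W) (y : cell U' X Y W') (z : cell U'' Y B W'') :
    x </> (y </> z) ≡ (x </> y) </> z
| vcomp_idl U A B W (x : cell U A B W) : vid A </> x ≡ x
| vcomp_idr U A B W (x : cell U A B W) : x </> vid B ≡ x
| hid_unit : hid eunit ≡ vid unit_ob
| vid_tens A B : vid (A ⊗ B)%obj ≡ vid A <|> vid B
| hid_tens U W : hid (U ⊗ W)%exch ≡ hid U </> hid W
| interchange U A X V U' B V' A' X' W B' W'
    (x : cell U A X V) (y : cell U' X B V')
    (z : cell V A' X' W) (t : cell V' X' B' W') :
    (x </> y) <|> (z </> t) ≡ (x <|> z) </> (y <|> t)
| box_comp A B X (f : hom A B) (g : hom B X) :
    box (comp f g) ≡ box f </> box g
| box_id A : box (idm A) ≡ vid A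
| box_tens A B A' B' (f : hom A B) (g : hom A' B') :
    box (tensm f g) ≡ box f <|> box g
| putR_getL A : putR A <|> getL A ≡ vid A
| getL_putR A : getL A </> putR A ≡ hid (ecirc A)
| getR_putL A : getR A <|> putL A ≡ vid A
| getR_putL_v A : getR A </> putL A ≡ hid (ebullet A)
| cprod_proj0 V A B U W (x : cell V A B U) (y : cell V A B W) :
    cprod x y <|> cproj0 U W ≡ x
| cprod_proj1 V A B U W (x : cell V A B U) (y : cell V A B W) :
    cprod x y <|> cproj1 U W ≡ y
| cprod_unique V A B U W (x : cell V A B U) (y : cell V A B W)
    (z : cell V A B (U × W)) :
    z <|> cproj0 U W ≡ x -> z <|> cproj1 U W ≡ y -> z ≡ cprod x y
| csum_inj0 U W A B V (x : cell U A B V) (y : cell W A B V) :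
    cinj0 U W <|> csum x y ≡ x
| csum_inj1 U W A B V (x : cell U A B V) (y : cell W A B V) :
    cinj1 U W <|> csum x y ≡ y
| csum_unique U W A B V (x : cell U A B V) (y : cell W A B V)
    (z : cell (U ∔ W) A B V) :
    cinj0 U W <|> z ≡ x -> cinj1 U W <|> z ≡ y -> z ≡ csum x y
| ccopair_inj0 U A B X W (x : cell U A X W) (y : cell U B X W) :
    box (inj0 A B) </> ccopair x y ≡ x
| ccopair_inj1 U A B X W (x : cell U A X W) (y : cell U B X W) :
    box (inj1 A B) </> ccopair x y ≡ y
| ccopair_unique U A B X W (x : cell U A X W) (y : cell U B X W)
    (z : cell U (A ⊕ B) X W) :
    box (inj0 A B) </> z ≡ x -> box (inj1 A B) </> z ≡ y -> z ≡ ccopair x y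
| citimes_proj0 V A U W B K (x : cell V A A U) (f : cell W A B K)
    (g : cell W unit_ob unit_ob (V ⊗ W)) :
    citimes x f g <|> (itimes_proj0 U </> hid K) ≡ f
| citimes_proj1 V A U W B K (x : cell V A A U) (f : cell W A B K)
    (g : cell W unit_ob unit_ob (V ⊗ W)) :
    citimes x f g <|> (itimes_proj1 U </> hid K)
      ≡ g <|> (x </> citimes x f g)
| citimes_unique V A U W B K (x : cell V A A U) (f : cell W A B K)
    (g : cell W unit_ob unit_ob (V ⊗ W)) (z : cell W A B (U^× ⊗ K)) :
    z <|> (itimes_proj0 U </> hid K) ≡ f ->
    z <|> (itimes_proj1 U </> hid K) ≡ g <|> (x </> z) ->
    z ≡ citimes x f g
| ciplus_inj0 U A V K B W (x : cell U A A V) (f : cell K A B W)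
    (g : cell (V ⊗ W) unit_ob unit_ob W) :
    (iplus_inj0 U </> hid K) <|> ciplus x f g ≡ f
| ciplus_inj1 U A V K B W (x : cell U A A V) (f : cell K A B W)
    (g : cell (V ⊗ W) unit_ob unit_ob W) :
    (iplus_inj1 U </> hid K) <|> ciplus x f g
      ≡ (x </> ciplus x f g) <|> g
| ciplus_unique U A V K B W (x : cell U A A V) (f : cell K A B W)
    (g : cell (V ⊗ W) unit_ob unit_ob W) (z : cell (U^∔ ⊗ K) A B W) :
    (iplus_inj0 U </> hid K) <|> z ≡ f ->
    (iplus_inj1 U </> hid K) <|> z ≡ (x </> z) <|> g ->
    z ≡ ciplus x f g
where "x ≡ y" := (cell_eq x y) : cell_scope.

Lemma cell_eq_boundary (C : dmcat) (U : exch C) A B W (x : cell U A B W)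
    U' A' B' W' (y : cell U' A' B' W') :
  x ≡ y -> [/\ U ≈ U', A = A', B = B' & W ≈ W'].
Proof.
induction 1;
  repeat match goal with H : and4 _ _ _ _ |- _ => case: H => * end; subst;
  split; rewrite ?tens_unitl ?tens_unitr ?tens_assoc //;
  by eauto using exch_refl, exch_sym, exch_trans, exch_tens_congr,
    exch_times_congr, exch_plus_congr, exch_itimes_congr, exch_iplus_congr,
    exch_assoc, exch_unitl, exch_unitr.
Qed.

Lemma ceq_castl (C : dmcat) (U : exch C) A B W (x : cell U A B W)
    U' A' B' W' (eU : U ≈ U') (eA : A = A') (eB : B = B') (eW : W ≈ W')
    U'' A'' B'' W'' (y : cell U'' A'' B'' W'') :
  x ≡ y -> cast eU eA eB eW x ≡ y.
Proof. exact: ceq_trans (ceq_cast _ _ _ _ _). Qed.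

Lemma ceq_castr (C : dmcat) (U : exch C) A B W (x : cell U A B W)
    U' A' B' W' (eU : U ≈ U') (eA : A = A') (eB : B = B') (eW : W ≈ W')
    U'' A'' B'' W'' (y : cell U'' A'' B'' W'') :
  y ≡ x -> y ≡ cast eU eA eB eW x.
Proof. by move=> e; apply: ceq_trans e (ceq_sym (ceq_cast _ _ _ _ _)). Qed.

Lemma vcomp_hid_unit (C : dmcat) (U : exch C) A W (x : cell U A unit_ob W) :
  x </> hid eunit ≡ x.
Proof.
apply: ceq_trans (vcomp_idr x).
exact: ceq_vcomp (ceq_refl _) (hid_unit C).
Qed.

Definition iter_times (C : dmcat) (U : exch C) (A : C) (W : exch C)
    (x : cell U A A W) : cell (U^×) A A (W^×) :=
  cast (exch_refl _) erefl erefl (exch_unitr _)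
    (citimes x
       (cast (exch_refl _) (tens_unitl A) (tens_unitl A) (exch_refl _)
          (itimes_proj0 U <|> vid A))
       (itimes_proj1 U)).

Definition iter_plus (C : dmcat) (U : exch C) (A : C) (W : exch C)
    (x : cell U A A W) : cell (U^∔) A A (W^∔) :=
  cast (exch_unitr _) erefl erefl (exch_refl _)
    (ciplus x
       (cast (exch_refl _) (tens_unitr A) (tens_unitr A) (exch_refl _)
          (vid A <|> iplus_inj0 W))
       (iplus_inj1 W)).

Lemma exch_units_l (C : dmcat) (U : exch C) : (U ⊗ eunit) ⊗ eunit ≈ U.
Proof. exact: exch_trans (exch_unitr _) (exch_unitr _). Qed.

Lemma exch_units_r (C : dmcat) (U : exch C) : (eunit ⊗ eunit) ⊗ U ≈ U.
Proof.
apply: exch_trans (exch_unitl U).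
exact: exch_tens_congr (exch_unitl _) (exch_refl _).
Qed.

(* By recursion on the expression representing an element of the monoid of
   exchanges; [chi_exch_eq] shows that it depends only on that element. *)
Fixpoint chi (C : dmcat) (U : exch C) (B : C) : cell U B B U :=
  match U with
  | ecirc A =>
      cast (exch_units_l _) (tens_unitl B) (tens_unitr B) (exch_units_r _)
        ((getL A <|> vid B) </> box (braid A B) </> (vid B <|> putR A))
  | ebullet A =>
      cast (exch_units_r _) (tens_unitr B) (tens_unitl B) (exch_units_l _)
        ((vid B <|> getR A) </> box (braid B A) </> (putL A <|> vid B))
  | eunit => vid B
  | U ⊗ W => chi U B </> chi W B
  | U × W =>
      cast (exch_refl _) (tens_unitl B) (tens_unitl B) (exch_refl _)
        (cprod (cproj0 U W <|> chi U B) (cproj1 U W <|> chi W B))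
  | U ∔ W =>
      cast (exch_refl _) (tens_unitr B) (tens_unitr B) (exch_refl _)
        (csum (chi U B <|> cinj0 U W) (chi W B <|> cinj1 U W))
  | U^× => iter_times (chi U B)
  | U^∔ => iter_plus (chi U B)
  end%exch.

Lemma chi_exch_eq (C : dmcat) (U W : exch C) (B : C) :
  U ≈ W -> chi U B ≡ chi W B.
Proof.
elim=> {U W} /=.
- by move=> U; exact: ceq_refl.
- by move=> U W _; exact: ceq_sym.
- by move=> U V W _ + _; exact: ceq_trans.
- by move=> U U' W W' _ IHU _ IHW; exact: ceq_vcomp.
- move=> U U' W W' eU IHU eW IHW; apply: ceq_castl; apply: ceq_castr.
  by apply: ceq_cprod; apply: ceq_hcomp => //;
    [exact: ceq_cproj0 | exact: ceq_cproj1].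
- move=> U U' W W' eU IHU eW IHW; apply: ceq_castl; apply: ceq_castr.
  by apply: ceq_csum; apply: ceq_hcomp => //;
    [exact: ceq_cinj0 | exact: ceq_cinj1].
- move=> U U' eU IHU; apply: ceq_castl; apply: ceq_castr.
  have eUi : U ⊗ U^× ≈ U' ⊗ U'^×.
    by apply: exch_tens_congr => //; exact: exch_itimes_congr.
  apply: ceq_citimes => //; do ?[apply: ceq_castl; apply: ceq_castr].
  + apply: ceq_hcomp (ceq_refl _); apply: ceq_castl; apply: ceq_castr.
    exact: ceq_cproj0 (exch_refl _) eUi.
  + exact: ceq_cproj1 (exch_refl _) eUi.
- move=> U U' eU IHU; apply: ceq_castl; apply: ceq_castr.
  have eUi : U ⊗ U^∔ ≈ U' ⊗ U'^∔.
    by apply: exch_tens_congr => //; exact: exch_iplus_congr.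
  apply: ceq_ciplus => //; do ?[apply: ceq_castl; apply: ceq_castr].
  + apply: ceq_hcomp (ceq_refl _) _; apply: ceq_castl; apply: ceq_castr.
    exact: ceq_cinj0 (exch_refl _) eUi.
  + exact: ceq_cinj1 (exch_refl _) eUi.
- by move=> U V W; exact: vcomp_assoc.
- by move=> U; exact: vcomp_idl.
- by move=> U; exact: vcomp_idr.
- move=> U; apply: ceq_castr; set z := iter_times _.
  have ez : z ≡ citimes (chi U B) _ _ := ceq_cast _ _ _ _ _.
  apply: ceq_trans (ceq_sym (ceq_cast (exch_itimes U)
    (esym (tens_unitl B)) (esym (tens_unitl B)) (exch_itimes U) z)) _.
  apply: cprod_unique.
  + apply: ceq_trans (ceq_trans (citimes_proj0 (chi U B)
      (cast (exch_refl _) (tens_unitl B) (tens_unitl B) (exch_refl _)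
          (itimes_proj0 U <|> vid B)) (itimes_proj1 U)) _).
      apply: ceq_hcomp; first exact: ceq_castl ez.
      apply: ceq_trans (ceq_sym (vcomp_hid_unit _)).
      by apply: ceq_castr; exact: ceq_refl.
    apply: ceq_castl; apply: ceq_hcomp (ceq_refl _).
    by apply: ceq_castl; exact: ceq_refl.
  + apply: ceq_trans (ceq_trans (citimes_proj1 (chi U B)
      (cast (exch_refl _) (tens_unitl B) (tens_unitl B) (exch_refl _)
          (itimes_proj0 U <|> vid B)) (itimes_proj1 U)) _).
      apply: ceq_hcomp; first exact: ceq_castl ez.
      apply: ceq_trans (ceq_sym (vcomp_hid_unit _)).
      by apply: ceq_castr; exact: ceq_refl.
    apply: ceq_hcomp; first by apply: ceq_castl; exact: ceq_refl.
    by apply: ceq_vcomp (ceq_refl _) (ceq_sym ez).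
- move=> U; apply: ceq_castr; set z := iter_plus _.
  have ez : z ≡ ciplus (chi U B) _ _ := ceq_cast _ _ _ _ _.
  apply: ceq_trans (ceq_sym (ceq_cast (exch_iplus U)
    (esym (tens_unitr B)) (esym (tens_unitr B)) (exch_iplus U) z)) _.
  apply: csum_unique.
  + apply: ceq_trans (ceq_trans (ciplus_inj0 (chi U B)
      (cast (exch_refl _) (tens_unitr B) (tens_unitr B) (exch_refl _)
          (vid B <|> iplus_inj0 U)) (iplus_inj1 U)) _).
      apply: ceq_hcomp; last exact: ceq_castl ez.
      apply: ceq_trans (ceq_sym (vcomp_hid_unit _)).
      by apply: ceq_castr; exact: ceq_refl.
    apply: ceq_castl; apply: ceq_hcomp (ceq_refl _) _.
    by apply: ceq_castl; exact: ceq_refl.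
  + apply: ceq_trans (ceq_trans (ciplus_inj1 (chi U B)
      (cast (exch_refl _) (tens_unitr B) (tens_unitr B) (exch_refl _)
          (vid B <|> iplus_inj0 U)) (iplus_inj1 U)) _).
      apply: ceq_hcomp; last exact: ceq_castl ez.
      apply: ceq_trans (ceq_sym (vcomp_hid_unit _)).
      by apply: ceq_castr; exact: ceq_refl.
    apply: ceq_hcomp; last by apply: ceq_castl; exact: ceq_refl.
    by apply: ceq_vcomp (ceq_refl _) (ceq_sym ez).
Qed.

(* Main.v *)
(** By induction on [U]. A cell with left boundary [A°] is determined by its
    composite with [putR A] on the left, which turns [chi A° B] into
    [braid A B] followed by [vid B <|> putR A]; so the case of [A°] reduces to
    the hexagon and to [braid A I = 1]. The case of [A•] is dual. In the
    remaining cases [chi A <|> chi B] and [hid U] commute with the projections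
    (injections, for sums) as [chi] does, so uniqueness applies. *)

From mathcomp Require Import ssreflect ssrfun ssrbool.
Require Import Defs.

Set Implicit Arguments.
Unset Strict Implicit.
Unset Printing Implicit Defensive.

Local Open Scope exch_scope.
Local Open Scope cell_scope.

(** * Composition up to equality of boundaries *)

(* Composites of cells whose common boundary agrees only up to [≈], resp. up to
   an equation of objects. Since [≡] ignores [cast], they satisfy the laws of a
   strict double category for any choice of boundary proofs. *)
Definition hc (C : dmcat) (U : exch C) A B V V' A' B' W
    (x : cell U A B V) (y : cell V' A' B' W) (e : V' ≈ V) :
    cell U (A ⊗ A')%obj (B ⊗ B')%obj W :=
  x <|> cast e erefl erefl (exch_refl _) y.

Definition vc (C : dmcat) (U : exch C) A X W U' X' B W'
    (x : cell U A X W) (y : cell U' X' B W') (e : X' = X) :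
    cell (U ⊗ U') A B (W ⊗ W') :=
  x </> cast (exch_refl _) e erefl (exch_refl _) y.

(** Deletes units and descends into tensors, without reassociating. The recursive call sits inside
    each alternative, so a deletion that leads nowhere is undone. *)
Ltac exch_units :=
  first [ exact: exch_refl
        | refine (exch_trans (exch_unitl _) _); exch_units
        | refine (exch_trans (exch_unitr _) _); exch_units
        | refine (exch_trans _ (exch_sym (exch_unitl _))); exch_units
        | refine (exch_trans _ (exch_sym (exch_unitr _))); exch_units
        | refine (exch_tens_congr _ _); exch_units ].

Ltac boundary :=
  solve [ exact: erefl
        | by rewrite ?tens_unitl ?tens_unitr ?tens_assoc
        | exch_units ].

(* [e] comes last in [hc] and [vc] so that both cells, hence both boundaries, are
   already elaborated when [boundary] runs. *)
Notation "x <|' y" := (hc x y ltac:(boundary))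
  (at level 54, left associativity, only parsing) : cell_scope.
Notation "x </' y" := (vc x y ltac:(boundary))
  (at level 53, left associativity, only parsing) : cell_scope.

Tactic Notation "via" open_constr(t) := refine (ceq_trans (y := t) _ _).

Section Strictification.
Variable C : dmcat.
Implicit Types (U V W : exch C) (A B X Y : C).

Lemma hcE U A B V A' B' W (e : V ≈ V)
    (x : cell U A B V) (y : cell V A' B' W) : hc x y e ≡ x <|> y.
Proof. by apply: ceq_hcomp (ceq_refl _) _; apply: ceq_cast. Qed.

Lemma vcE U A X W U' B W' (e : X = X)
    (x : cell U A X W) (y : cell U' X B W') : vc x y e ≡ x </> y.
Proof. by apply: ceq_vcomp (ceq_refl _) _; apply: ceq_cast. Qed.

Lemma ceq_hc U A B V V' A' B' W (e : V' ≈ V)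
    U_ A_ B_ V_ V'_ A'_ B'_ W_ (e_ : V'_ ≈ V_)
    (x : cell U A B V) (y : cell V' A' B' W)
    (x_ : cell U_ A_ B_ V_) (y_ : cell V'_ A'_ B'_ W_) :
  x ≡ x_ -> y ≡ y_ -> hc x y e ≡ hc x_ y_ e_.
Proof.
by move=> ex ey; apply: ceq_hcomp ex _; apply: ceq_castl; apply: ceq_castr.
Qed.

Lemma ceq_vc U A X W U' X' B W' (e : X' = X)
    U_ A_ X_ W_ U'_ X'_ B_ W'_ (e_ : X'_ = X_)
    (x : cell U A X W) (y : cell U' X' B W')
    (x_ : cell U_ A_ X_ W_) (y_ : cell U'_ X'_ B_ W'_) :
  x ≡ x_ -> y ≡ y_ -> vc x y e ≡ vc x_ y_ e_.
Proof.
by move=> ex ey; apply: ceq_vcomp ex _; apply: ceq_castl; apply: ceq_castr.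
Qed.

Lemma hcompE U A B V A' B' W U_ A_ B_ V_ V'_ A'_ B'_ W_ (e_ : V'_ ≈ V_)
    (x : cell U A B V) (y : cell V A' B' W)
    (x_ : cell U_ A_ B_ V_) (y_ : cell V'_ A'_ B'_ W_) :
  x ≡ x_ -> y ≡ y_ -> x <|> y ≡ hc x_ y_ e_.
Proof.
by move=> ex ey; apply: ceq_trans (ceq_sym (hcE (exch_refl _) _ _)) _;
  apply: ceq_hc.
Qed.

Lemma vcompE U A X W U' B W' U_ A_ X_ W_ U'_ X'_ B_ W'_ (e_ : X'_ = X_)
    (x : cell U A X W) (y : cell U' X B W')
    (x_ : cell U_ A_ X_ W_) (y_ : cell U'_ X'_ B_ W'_) :
  x ≡ x_ -> y ≡ y_ -> x </> y ≡ vc x_ y_ e_.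
Proof.
by move=> ex ey; apply: ceq_trans (ceq_sym (vcE erefl _ _)) _;
  apply: ceq_vc.
Qed.

Lemma hc_assoc U A B V V1 A' B' V' V1' A'' B'' W
    (x : cell U A B V) (y : cell V1 A' B' V') (z : cell V1' A'' B'' W)
    e1 e2 e3 e4 :
  hc x (hc y z e2) e1 ≡ hc (hc x y e4) z e3.
Proof.
(* Here and in the next two lemmas the strict law is instantiated at factors cast to matching
   boundaries; both sides of the goal differ from it only by casts. *)
apply: ceq_trans (ceq_trans (hcomp_assoc x (cast e4 erefl erefl (exch_refl _) y)
  (cast e2 erefl erefl (exch_refl _) z)) _).
  apply: ceq_hcomp (ceq_refl _) _; apply: ceq_castl.
  by apply: ceq_hcomp (ceq_refl _); apply: ceq_castr (ceq_refl _).
apply: ceq_hcomp (ceq_refl _) _.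
by apply: ceq_castl; apply: ceq_castr (ceq_refl _).
Qed.

Lemma vc_assoc U A X W U' X1 Y W' U'' Y1 B W''
    (x : cell U A X W) (y : cell U' X1 Y W') (z : cell U'' Y1 B W'')
    e1 e2 e3 e4 :
  vc x (vc y z e2) e1 ≡ vc (vc x y e4) z e3.
Proof.
apply: ceq_trans (ceq_trans (vcomp_assoc x
  (cast (exch_refl _) e4 erefl (exch_refl _) y)
  (cast (exch_refl _) e2 erefl (exch_refl _) z)) _).
  apply: ceq_vcomp (ceq_refl _) _; apply: ceq_castl.
  by apply: ceq_vcomp (ceq_refl _); apply: ceq_castr (ceq_refl _).
apply: ceq_vcomp (ceq_refl _) _.
by apply: ceq_castl; apply: ceq_castr (ceq_refl _).
Qed.

Lemma hc_vc U A X V U' X1 B V' V1 A' X' W V1' X1' B' W'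
    (x : cell U A X V) (y : cell U' X1 B V')
    (z : cell V1 A' X' W) (t : cell V1' X1' B' W') e ea eb ec ed ef :
  hc (vc x y ea) (vc z t eb) e ≡ vc (hc x z ed) (hc y t ef) ec.
Proof.
apply: ceq_trans (ceq_trans (interchange x
  (cast (exch_refl _) ea erefl (exch_refl _) y)
  (cast ed erefl erefl (exch_refl _) z)
  (cast ef eb erefl (exch_refl _) t)) _).
  apply: ceq_hcomp (ceq_refl _) _; apply: ceq_castl.
  by apply: ceq_vcomp; apply: ceq_castr (ceq_refl _) || apply: ceq_castl;
    apply: ceq_castr (ceq_refl _).
apply: ceq_vcomp (ceq_refl _) _; apply: ceq_castr.
by apply: ceq_hcomp; apply: ceq_castl => //;
  [apply: ceq_refl | apply: ceq_castr (ceq_refl _)].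
Qed.

Lemma hc_idl U V A B W (x : cell U A B W) (e : U ≈ V) : hc (hid V) x e ≡ x.
Proof. exact: ceq_trans (hcomp_idl _) (ceq_cast _ _ _ _ _). Qed.

Lemma hc_idr U V A B W (x : cell U A B W) (e : V ≈ W) : hc x (hid V) e ≡ x.
Proof.
apply: ceq_trans (hcomp_idr x); apply: ceq_hcomp (ceq_refl _) _.
by apply: ceq_castl; apply: ceq_hid.
Qed.

Lemma vc_idl U A X B W (x : cell U A B W) (e : A = X) : vc (vid X) x e ≡ x.
Proof. exact: ceq_trans (vcomp_idl _) (ceq_cast _ _ _ _ _). Qed.

Lemma vc_idr U A X B W (x : cell U A B W) (e : X = B) : vc x (vid X) e ≡ x.
Proof.
subst X; exact: ceq_trans (vcE _ _ _) (vcomp_idr x).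
Qed.

(** By [hid_unit], [vid unit_ob] is the horizontal unit at [eunit] as well. *)
Lemma hc_vid1l U A B W (x : cell U A B W) (e : U ≈ eunit) :
  hc (vid unit_ob) x e ≡ x.
Proof.
exact: ceq_trans (ceq_hc e e (ceq_sym (hid_unit C)) (ceq_refl _)) (hc_idl x e).
Qed.

Lemma hc_vid1r U A B W (x : cell U A B W) (e : eunit ≈ W) :
  hc x (vid unit_ob) e ≡ x.
Proof.
exact: ceq_trans (ceq_hc e e (ceq_refl _) (ceq_sym (hid_unit C))) (hc_idr x e).
Qed.

(** * The braiding as a cell: symmetry, hexagons and units *)

Lemma vid_eq A B : A = B -> vid A ≡ vid B.
Proof. by move->; apply: ceq_refl. Qed.

Lemma vid_hc A B : vid (A ⊗ B)%obj ≡ vid A <|' vid B.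
Proof. exact: ceq_trans (vid_tens _ _) (ceq_sym (hcE _ _ _)). Qed.

(** Since [≡] is heterogeneous, the transports in the hexagon of the strict tensor disappear at the
    level of cells. *)
Lemma box_transport A B A' B' (eA : A = A') (eB : B = B') (f : hom A B) :
  box (transport2 eA eB f) ≡ box f.
Proof. by case: _ / eA; case: _ / eB; apply: ceq_refl. Qed.

Lemma box_braid_eq A A' B B' :
  A = A' -> B = B' -> box (braid A B) ≡ box (braid A' B').
Proof. by move=> -> ->; apply: ceq_refl. Qed.

Lemma box_braid_sym A B :
  box (braid A B) </' box (braid B A) ≡ vid (A ⊗ B)%obj.
Proof.
apply: ceq_trans (vcE _ _ _) _; apply: ceq_trans (ceq_sym (box_comp _ _)) _.
by rewrite braid_sym; apply: box_id.
Qed.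

Lemma box_braid_tensr A B X :
  box (braid A (B ⊗ X)%obj) ≡
  (box (braid A B) <|' vid X) </' (vid B <|' box (braid A X)).
Proof.
apply: ceq_trans (ceq_sym (box_transport (tens_assoc A B X) erefl _)) _.
rewrite braid_hexagon.
apply: ceq_trans (box_comp _ _) _.
apply: vcompE; last apply: ceq_trans (box_transport _ _ _) _;
  apply: ceq_trans (box_tens _ _) _;
  by apply: hcompE; [exact: ceq_refl || exact: box_id..].
Qed.

#[local] Hint Resolve ceq_refl : core.

(** The other hexagon. The cell [u] has [box (braid (A ⊗ B) X)] as left inverse by symmetry, and [v]
    as right inverse by [box_braid_tensr], so the two inverses agree. *)
Lemma box_braid_tensl A B X :
  box (braid (A ⊗ B)%obj X) ≡
  (vid A <|' box (braid B X)) </' (box (braid A X) <|' vid B).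
Proof.
set u := box (braid X (A ⊗ B)%obj); 
set v := ((vid A <|' box (braid B X)) </' (box (braid A X) <|' vid B)).
have uv : vid (X ⊗ (A ⊗ B))%obj ≡ u </' v.
  apply: ceq_sym.
  via ((box (braid X A) <|' vid B) </' (vid A <|' box (braid X B)) </' v).
    by apply: ceq_vc => //; exact: box_braid_tensr.
  (* Reassociating brings the two braidings of [X] with [B] together; once they cancel, so do those
     of [X] with [A]. *)
  via ((box (braid X A) <|' vid B) </'
       (((vid A <|' box (braid X B)) </' (vid A <|' box (braid B X))) </'
        (box (braid A X) <|' vid B))).
    via ((box (braid X A) <|' vid B) </' ((vid A <|' box (braid X B)) </' v)).
      by apply: ceq_sym; exact: vc_assoc.
    by apply: ceq_vc => //; exact: vc_assoc.
  via ((box (braid X A) <|' vid B) </' (box (braid A X) <|' vid B)).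
    apply: ceq_vc => //.
    via (vid (A ⊗ (X ⊗ B))%obj </' (box (braid A X) <|' vid B)); last exact: vc_idl.
    apply: ceq_vc => //.
    via ((vid A </' vid A) <|' (box (braid X B) </' box (braid B X))).
      by apply: ceq_sym; exact: hc_vc.
    apply: ceq_trans (ceq_sym (vid_hc _ _)).
    by apply: ceq_hc; [exact: vc_idl | exact: box_braid_sym].
  via ((box (braid X A) </' box (braid A X)) <|' (vid B </' vid B)).
    by apply: ceq_sym; exact: hc_vc.
  rewrite tens_assoc; apply: ceq_trans (ceq_sym (vid_hc _ _)).
  by apply: ceq_hc; [exact: box_braid_sym | exact: vc_idl].
via (box (braid (A ⊗ B)%obj X) </' vid (X ⊗ (A ⊗ B))%obj).
  by apply: ceq_sym; exact: vc_idr.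
via (box (braid (A ⊗ B)%obj X) </' (u </' v)).
  by apply: ceq_vc.
via ((box (braid (A ⊗ B)%obj X) </' u) </' v).
  exact: vc_assoc.
via (vid ((A ⊗ B) ⊗ X)%obj </' v); last exact: vc_idl.
by apply: ceq_vc => //; exact: box_braid_sym.
Qed.

(* The braiding [A, I] is idempotent by the hexagon at [I ⊗ I = I], and invertible. *)
Lemma box_braid_1r A : box (braid A unit_ob) ≡ vid A.
Proof.
set s := box _; set t := box (braid unit_ob A).
have ss : s ≡ s </' s.
  via (box (braid A (unit_ob ⊗ unit_ob)%obj)).
    by apply: box_braid_eq => //; rewrite tens_unitl.
  apply: ceq_trans (box_braid_tensr _ _ _) _.
  by apply: ceq_vc; [exact: hc_vid1r | exact: hc_vid1l].
have st : s </' t ≡ vid A.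
  by apply: ceq_trans (box_braid_sym _ _) _; apply: vid_eq; rewrite tens_unitr.
(* An idempotent with a right inverse is the identity: [s = s (s t) = (s s) t = s t]. *)
apply: (ceq_trans _ st).
via (s </' vid A); first by apply: ceq_sym; exact: vc_idr.
via (s </' (s </' t)); first by apply: ceq_vc => //; exact: ceq_sym st.
via ((s </' s) </' t); first exact: vc_assoc.
by apply: ceq_vc => //; exact: ceq_sym ss.
Qed.

Lemma box_braid_1l A : box (braid unit_ob A) ≡ vid A.
Proof.
via (box (braid A unit_ob) </' box (braid unit_ob A)).
  via (vid A </' box (braid unit_ob A)); first by apply: ceq_sym; exact: vc_idl.
  by apply: ceq_vc => //; apply: ceq_sym; exact: box_braid_1r.
by apply: ceq_trans (box_braid_sym _ _) _; apply: vid_eq; rewrite tens_unitr.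
Qed.

(** * Crossings of the generators [A°] and [A•] *)

(** Insert [hid (ecirc A)], written as [getL A </' putR A], to the left of [vid B </' x] and
    interchange. Thus [x] is recovered from [putR A <|' x]. *)
Lemma getL_putR_expand A B B' W (x : cell (ecirc A) B B' W) :
  x ≡ (getL A <|' vid B) </' (putR A <|' x).
Proof.
apply: ceq_sym.
via ((getL A </' putR A) <|' (vid B </' x)).
  by apply: ceq_sym; exact: hc_vc.
via (hid (ecirc A) <|' x); last exact: hc_idl.
apply: ceq_hc; last exact: vc_idl.
exact: ceq_trans (vcE _ _ _) (getL_putR A).
Qed.

Lemma getR_putL_expand A B B' U (x : cell U B B' (ebullet A)) :
  x ≡ (vid B <|' getR A) </' (x <|' putL A).
Proof.
apply: ceq_sym.
via ((vid B </' x) <|' (getR A </' putL A)).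
  by apply: ceq_sym; exact: hc_vc.
via (x <|' hid (ebullet A)); last exact: hc_idr.
apply: ceq_hc; first exact: vc_idl.
exact: ceq_trans (vcE _ _ _) (getR_putL_v A).
Qed.

(** The corner [getL A] at the top of the crossing cancels against [putR A] by [putR_getL]. *)
Lemma putR_chi A B :
  putR A <|' chi (ecirc A) B ≡ box (braid A B) </' (vid B <|' putR A).
Proof.
set s := box _; set p := (vid B <|' putR A).
(* Padding [putR A] with an identity below gives it two rows, so that interchange pairs it with the
   row of [getL A] alone. *)
via ((putR A </' vid (unit_ob : C)) <|' ((getL A <|' vid B) </' (s </' p))).
  apply: ceq_hc; first by apply: ceq_sym; exact: vc_idr.
  apply: ceq_castl; apply: ceq_trans (ceq_sym (vcomp_assoc _ _ _)) _.
  apply: vcompE; first by apply: hcompE.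
  by apply: vcompE => //; apply: hcompE.
via ((putR A <|' (getL A <|' vid B)) </' (vid (unit_ob : C) <|' (s </' p))).
  exact: hc_vc.
via (vid (A ⊗ B)%obj </' (s </' p)); last exact: vc_idl.
apply: ceq_vc; last exact: hc_vid1l.
via ((putR A <|' getL A) <|' vid B); first exact: hc_assoc.
apply: ceq_trans (ceq_sym (vid_hc _ _)); apply: ceq_hc => //.
exact: ceq_trans (hcE _ _ _) (putR_getL A).
Qed.

Lemma chi_putL A B :
  chi (ebullet A) B <|' putL A ≡ box (braid B A) </' (putL A <|' vid B).
Proof.
set s := box _; set p := (putL A <|' vid B).
via (((vid B <|' getR A) </' (s </' p)) <|' (putL A </' vid (unit_ob : C))).
  apply: ceq_hc; last by apply: ceq_sym; exact: vc_idr.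
  apply: ceq_castl; apply: ceq_trans (ceq_sym (vcomp_assoc _ _ _)) _.
  apply: vcompE; first by apply: hcompE.
  by apply: vcompE => //; apply: hcompE.
via (((vid B <|' getR A) <|' putL A) </' ((s </' p) <|' vid (unit_ob : C))).
  exact: hc_vc.
via (vid (B ⊗ A)%obj </' (s </' p)); last exact: vc_idl.
apply: ceq_vc; last exact: hc_vid1r.
via (vid B <|' (getR A <|' putL A)).
  by apply: ceq_sym; exact: hc_assoc.
apply: ceq_trans (ceq_sym (vid_hc _ _)); apply: ceq_hc => //.
exact: ceq_trans (hcE _ _ _) (getR_putL A).
Qed.

Lemma chi_circ_tens D A B :
  chi (ecirc D) (A ⊗ B)%obj ≡ chi (ecirc D) A <|> chi (ecirc D) B.
Proof.
(* With both sides expanded, only their composites with [putR D] remain to be compared. *)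
apply: ceq_trans (getL_putR_expand _) _.
apply: ceq_trans (ceq_sym (getL_putR_expand _)).
apply: ceq_vc => //; apply: ceq_trans (putR_chi _ _) _; apply: ceq_sym.
set s := box (braid D A); set s' := box (braid D B).
set c := chi _ A; set c' := chi _ B.
(* Moving [putR D] past [c] produces [s], and past [c'] produces [s']; stacked, these form the
   hexagon for [braid D (A ⊗ B)]. *)
via ((putR D <|' c) <|' c').
  via (putR D <|' (c <|' c')); last exact: hc_assoc.
  by apply: ceq_hc => //; exact: hcompE.
via ((s </' (vid A <|' putR D)) <|' (vid B </' c')).
  by apply: ceq_hc; [exact: putR_chi | apply: ceq_sym; exact: vc_idl].
via ((s <|' vid B) </' ((vid A <|' putR D) <|' c')).
  exact: hc_vc.
via ((s <|' vid B) </' ((vid A <|' s') </' (vid A <|' (vid B <|' putR D)))).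
  apply: ceq_vc => //.
  via (vid A <|' (putR D <|' c')); first by apply: ceq_sym; exact: hc_assoc.
  via ((vid A </' vid A) <|' (s' </' (vid B <|' putR D))); last exact: hc_vc.
  by apply: ceq_hc; [apply: ceq_sym; exact: vc_idl | exact: putR_chi].
via ((s <|' vid B) </' (vid A <|' s') </' (vid A <|' (vid B <|' putR D))).
  exact: vc_assoc.
apply: ceq_vc; first by apply: ceq_sym; exact: box_braid_tensr.
via (vid A <|' vid B <|' putR D); first exact: hc_assoc.
by apply: ceq_hc => //; apply: ceq_sym; exact: vid_hc.
Qed.

(** Mirror image of the previous lemma: [putL D] enters from the right and passes [c'] before [c],
    which calls for [box_braid_tensl]. *)
Lemma chi_bullet_tens D A B :
  chi (ebullet D) (A ⊗ B)%obj ≡ chi (ebullet D) A <|> chi (ebullet D) B.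
Proof.
apply: ceq_trans (getR_putL_expand _) _.
apply: ceq_trans (ceq_sym (getR_putL_expand _)).
apply: ceq_vc => //; apply: ceq_trans (chi_putL _ _) _; apply: ceq_sym.
set s := box (braid A D); set s' := box (braid B D).
set c := chi _ A; set c' := chi _ B.
via (c <|' (c' <|' putL D)).
  via ((c <|' c') <|' putL D); last by apply: ceq_sym; exact: hc_assoc.
  by apply: ceq_hc => //; exact: hcompE.
via ((vid A </' c) <|' (s' </' (putL D <|' vid B))).
  by apply: ceq_hc; [apply: ceq_sym; exact: vc_idl | exact: chi_putL].
via ((vid A <|' s') </' (c <|' (putL D <|' vid B))).
  exact: hc_vc.
via ((vid A <|' s') </' ((s <|' vid B) </' (putL D <|' vid A <|' vid B))).
  apply: ceq_vc => //.
  via ((c <|' putL D) <|' vid B); first exact: hc_assoc.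
  via ((s </' (putL D <|' vid A)) <|' (vid B </' vid B)); last exact: hc_vc.
  by apply: ceq_hc; [exact: chi_putL | apply: ceq_sym; exact: vc_idl].
via ((vid A <|' s') </' (s <|' vid B) </' (putL D <|' vid A <|' vid B)).
  exact: vc_assoc.
apply: ceq_vc; first by apply: ceq_sym; exact: box_braid_tensl.
via (putL D <|' (vid A <|' vid B)); first by apply: ceq_sym; exact: hc_assoc.
by apply: ceq_hc => //; apply: ceq_sym; exact: vid_hc.
Qed.

(** As [braid D I] is the identity, both sides give [putR D] when composed with [putR D] on the
    left. *)
Lemma chi_circ_unit (D : C) : chi (ecirc D) unit_ob ≡ hid (ecirc D).
Proof.
apply: ceq_trans (getL_putR_expand _) _.
apply: ceq_trans (ceq_sym (getL_putR_expand _)).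
apply: ceq_vc => //; apply: ceq_trans (putR_chi _ _) _.
via (putR D); last by apply: ceq_sym; exact: hc_idr.
via (vid D </' putR D); last exact: vc_idl.
by apply: ceq_vc; [exact: box_braid_1r | exact: hc_vid1l].
Qed.

Lemma chi_bullet_unit (D : C) : chi (ebullet D) unit_ob ≡ hid (ebullet D).
Proof.
apply: ceq_trans (getR_putL_expand _) _.
apply: ceq_trans (ceq_sym (getR_putL_expand _)).
apply: ceq_vc => //; apply: ceq_trans (chi_putL _ _) _.
via (putL D); last by apply: ceq_sym; exact: hc_idl.
via (vid D </' putL D); last exact: vc_idl.
by apply: ceq_vc; [exact: box_braid_1l | exact: hc_vid1r].
Qed.

(** * Commuting squares, and the crossings of products and sums *)

(* [x <|> q ≡ p <|> x'] says that the pair [(x, x')] commutes with [p] and [q];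
   such squares paste horizontally. *)
Lemma square_hcomp U V W U' V' W' A A' B B'
    (p : cell U unit_ob unit_ob U') (q : cell V unit_ob unit_ob V')
    (r : cell W unit_ob unit_ob W')
    (x : cell U A A' V) (x' : cell U' A A' V')
    (y : cell V B B' W) (y' : cell V' B B' W') :
  x <|> q ≡ p <|> x' -> y <|> r ≡ q <|> y' ->
  (x <|> y) <|> r ≡ p <|> (x' <|> y').
Proof.
move=> xq yr; via (x <|> (y <|> r)); first by apply: ceq_sym; exact: hcomp_assoc.
via (x <|> (q <|> y')); first exact: ceq_hcomp.
via ((x <|> q) <|> y'); first exact: hcomp_assoc.
via ((p <|> x') <|> y'); first exact: ceq_hcomp.
by apply: ceq_sym; exact: hcomp_assoc.
Qed.

Lemma square_hid U U' (p : cell U unit_ob unit_ob U') :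
  hid U <|> p ≡ p <|> hid U'.
Proof. exact: ceq_trans (hcomp_idl p) (ceq_sym (hcomp_idr p)). Qed.

Lemma chi_times_proj0 U W B :
  chi (U × W) B <|> cproj0 U W ≡ cproj0 U W <|> chi U B.
Proof.
apply: ceq_trans (cprod_proj0 (cproj0 U W <|> chi U B) (cproj1 U W <|> chi W B)).
by apply: ceq_hcomp => //; exact: ceq_cast.
Qed.

Lemma chi_times_proj1 U W B :
  chi (U × W) B <|> cproj1 U W ≡ cproj1 U W <|> chi W B.
Proof.
apply: ceq_trans (cprod_proj1 (cproj0 U W <|> chi U B) (cproj1 U W <|> chi W B)).
by apply: ceq_hcomp => //; exact: ceq_cast.
Qed.

(** Uniqueness of pairing: the two projection squares above characterise [chi (U × W) B], so any
    other solution equals it. *)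
Lemma chi_times_unique U W B (z : cell (U × W) B B (U × W)) :
  z <|> cproj0 U W ≡ cproj0 U W <|> chi U B ->
  z <|> cproj1 U W ≡ cproj1 U W <|> chi W B ->
  z ≡ chi (U × W) B.
Proof.
move=> z0 z1; apply: ceq_castr.
(* The pairing in the definition of [chi] has top and bottom [unit_ob ⊗ B], so [z] is recast to
   these before uniqueness is applied. *)
pose eB := esym (tens_unitl B).
apply: ceq_trans (ceq_sym (ceq_cast (exch_refl _) eB eB (exch_refl _) z)) _.
apply: cprod_unique; [apply: ceq_trans z0 | apply: ceq_trans z1];
  by apply: ceq_hcomp => //; exact: ceq_cast.
Qed.

(** Oriented to fit [square_hcomp], with the injection as both [p] and [q]. *)
Lemma chi_plus_inj0 U W B :
  chi U B <|> cinj0 U W ≡ cinj0 U W <|> chi (U ∔ W) B.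
Proof.
apply: ceq_sym.
apply: ceq_trans (csum_inj0 (chi U B <|> cinj0 U W) (chi W B <|> cinj1 U W)).
by apply: ceq_hcomp => //; exact: ceq_cast.
Qed.

Lemma chi_plus_inj1 U W B :
  chi W B <|> cinj1 U W ≡ cinj1 U W <|> chi (U ∔ W) B.
Proof.
apply: ceq_sym.
apply: ceq_trans (csum_inj1 (chi U B <|> cinj0 U W) (chi W B <|> cinj1 U W)).
by apply: ceq_hcomp => //; exact: ceq_cast.
Qed.

Lemma chi_plus_unique U W B (z : cell (U ∔ W) B B (U ∔ W)) :
  chi U B <|> cinj0 U W ≡ cinj0 U W <|> z ->
  chi W B <|> cinj1 U W ≡ cinj1 U W <|> z ->
  z ≡ chi (U ∔ W) B.
Proof.
move=> z0 z1; apply: ceq_castr.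
pose eB := esym (tens_unitr B).
apply: ceq_trans (ceq_sym (ceq_cast (exch_refl _) eB eB (exch_refl _) z)) _.
apply: csum_unique; [apply: ceq_trans (ceq_sym z0) | apply: ceq_trans (ceq_sym z1)];
  by apply: ceq_hcomp => //; exact: ceq_cast.
Qed.

(** * Iterated cells: defining equations, uniqueness and functoriality *)

Section Iteration.
Variables (U W : exch C) (A : C) (x : cell U A A W).

(** The case [K = eunit] of [citimes_proj0], where the row [hid K] is absorbed by
    [vcomp_hid_unit]. *)
Lemma iter_times_proj0 :
  iter_times x <|> itimes_proj0 W ≡ itimes_proj0 U <|> vid A.
Proof.
set f := cast (exch_refl _) (tens_unitl A) (tens_unitl A) (exch_refl _)
  (itimes_proj0 U <|> vid A).
via f; last exact: ceq_cast.
apply: ceq_trans (citimes_proj0 x f (itimes_proj1 U)).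
apply: ceq_hcomp; first exact: ceq_cast.
by apply: ceq_sym; exact: vcomp_hid_unit.
Qed.

Lemma iter_times_proj1 :
  iter_times x <|> itimes_proj1 W ≡ itimes_proj1 U <|> (x </> iter_times x).
Proof.
set f := cast (exch_refl _) (tens_unitl A) (tens_unitl A) (exch_refl _)
  (itimes_proj0 U <|> vid A).
via (itimes_proj1 U <|> (x </> citimes x f (itimes_proj1 U))).
  apply: ceq_trans (citimes_proj1 x f (itimes_proj1 U)).
  apply: ceq_hcomp; first exact: ceq_cast.
  by apply: ceq_sym; exact: vcomp_hid_unit.
by apply: ceq_hcomp => //; apply: ceq_vcomp => //; apply: ceq_sym; exact: ceq_cast.
Qed.

(** Coinduction principle: a cell satisfying both unfolding equations is the iterate. *)
Lemma iter_times_unique (z : cell (U^×) A A (W^×)) :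
  z <|> itimes_proj0 W ≡ itimes_proj0 U <|> vid A ->
  z <|> itimes_proj1 W ≡ itimes_proj1 U <|> (x </> z) ->
  z ≡ iter_times x.
Proof.
move=> z0 z1; apply: ceq_castr.
(* The right boundary becomes [W^× ⊗ eunit], the shape that [citimes_unique] expects. *)
set zc := cast (exch_refl _) erefl erefl (exch_sym (exch_unitr _)) z.
have zcE : zc ≡ z := ceq_cast _ _ _ _ _.
via zc; first exact: ceq_sym.
apply: citimes_unique.
  apply: ceq_castr; apply: ceq_trans z0; apply: ceq_hcomp => //.
  exact: vcomp_hid_unit.
via (z <|> itimes_proj1 W); first by apply: ceq_hcomp => //; exact: vcomp_hid_unit.
apply: ceq_trans z1 _; apply: ceq_hcomp => //.
by apply: ceq_vcomp => //; exact: ceq_sym.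
Qed.

Lemma iter_plus_inj0 :
  vid A <|> iplus_inj0 W ≡ iplus_inj0 U <|> iter_plus x.
Proof.
set f := cast (exch_refl _) (tens_unitr A) (tens_unitr A) (exch_refl _)
  (vid A <|> iplus_inj0 W).
apply: ceq_sym; via f; last exact: ceq_cast.
apply: ceq_trans (ciplus_inj0 x f (iplus_inj1 W)).
apply: ceq_hcomp; last exact: ceq_cast.
by apply: ceq_sym; exact: vcomp_hid_unit.
Qed.

Lemma iter_plus_inj1 :
  (x </> iter_plus x) <|> iplus_inj1 W ≡ iplus_inj1 U <|> iter_plus x.
Proof.
set f := cast (exch_refl _) (tens_unitr A) (tens_unitr A) (exch_refl _)
  (vid A <|> iplus_inj0 W).
apply: ceq_sym; via ((x </> ciplus x f (iplus_inj1 W)) <|> iplus_inj1 W).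
  apply: ceq_trans (ciplus_inj1 x f (iplus_inj1 W)).
  apply: ceq_hcomp; last exact: ceq_cast.
  by apply: ceq_sym; exact: vcomp_hid_unit.
by apply: ceq_hcomp => //; apply: ceq_vcomp => //; apply: ceq_sym; exact: ceq_cast.
Qed.

Lemma iter_plus_unique (z : cell (U^∔) A A (W^∔)) :
  vid A <|> iplus_inj0 W ≡ iplus_inj0 U <|> z ->
  (x </> z) <|> iplus_inj1 W ≡ iplus_inj1 U <|> z ->
  z ≡ iter_plus x.
Proof.
move=> z0 z1; apply: ceq_castr.
(* Dually, the left boundary becomes [U^∔ ⊗ eunit]. *)
set zc := cast (exch_sym (exch_unitr _)) erefl erefl (exch_refl _) z.
have zcE : zc ≡ z := ceq_cast _ _ _ _ _.
via zc; first exact: ceq_sym.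
apply: ciplus_unique.
  apply: ceq_castr; apply: ceq_trans (ceq_sym z0); apply: ceq_hcomp => //.
  exact: vcomp_hid_unit.
via (iplus_inj1 U <|> z); first by apply: ceq_hcomp => //; exact: vcomp_hid_unit.
apply: ceq_trans (ceq_sym z1) _; apply: ceq_hcomp => //.
by apply: ceq_vcomp => //; exact: ceq_sym.
Qed.

End Iteration.

Lemma ceq_iter_times U W A (x y : cell U A A W) :
  x ≡ y -> iter_times x ≡ iter_times y.
Proof.
by move=> xy; apply: ceq_castl; apply: ceq_castr; exact: ceq_citimes.
Qed.

Lemma ceq_iter_plus U W A (x y : cell U A A W) :
  x ≡ y -> iter_plus x ≡ iter_plus y.
Proof.
by move=> xy; apply: ceq_castl; apply: ceq_castr; exact: ceq_ciplus.
Qed.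

(** Pasting the unfolding squares of the two iterates, then applying interchange, shows that their
    composite satisfies the unfolding equations of [x <|> y]. *)
Lemma iter_times_hcomp U V W A B (x : cell U A A V) (y : cell V B B W) :
  iter_times x <|> iter_times y ≡ iter_times (x <|> y).
Proof.
apply: iter_times_unique.
  via (itimes_proj0 U <|> (vid A <|> vid B)).
    by apply: square_hcomp (iter_times_proj0 x) (iter_times_proj0 y).
  by apply: ceq_hcomp => //; apply: ceq_sym; exact: vid_tens.
via (itimes_proj1 U <|> ((x </> iter_times x) <|> (y </> iter_times y))).
  by apply: square_hcomp (iter_times_proj1 x) (iter_times_proj1 y).
by apply: ceq_hcomp => //; exact: interchange.
Qed.

(** Identities slide past the projections; [hid_unit] and [hid_tens] put the results in the form
    required by uniqueness. *)
Lemma iter_times_hid U : hid (U^×) ≡ iter_times (hid U).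
Proof.
apply: iter_times_unique; apply: ceq_trans (square_hid _) _;
  apply: ceq_hcomp => //; [exact: hid_unit | exact: hid_tens].
Qed.

Lemma iter_plus_hcomp U V W A B (x : cell U A A V) (y : cell V B B W) :
  iter_plus x <|> iter_plus y ≡ iter_plus (x <|> y).
Proof.
apply: iter_plus_unique.
  via ((vid A <|> vid B) <|> iplus_inj0 W).
    by apply: ceq_hcomp => //; exact: vid_tens.
  by apply: square_hcomp (iter_plus_inj0 x) (iter_plus_inj0 y).
via (((x </> iter_plus x) <|> (y </> iter_plus y)) <|> iplus_inj1 W).
  by apply: ceq_hcomp => //; apply: ceq_sym; exact: interchange.
by apply: square_hcomp (iter_plus_inj1 x) (iter_plus_inj1 y).
Qed.

Lemma iter_plus_hid U : hid (U^∔) ≡ iter_plus (hid U).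
Proof.
apply: iter_plus_unique; apply: ceq_trans (square_hid _);
  apply: ceq_hcomp => //; apply: ceq_sym; [exact: hid_unit | exact: hid_tens].
Qed.

(** * The inductions over exchanges *)

Lemma chi_tens U A B : chi U (A ⊗ B)%obj ≡ chi U A <|> chi U B.
Proof.
elim: U => [D|D||U IHU W IHW|U IHU W IHW|U IHU W IHW|U IHU|U IHU].
- exact: chi_circ_tens.
- exact: chi_bullet_tens.
- exact: vid_tens.
- apply: ceq_trans (ceq_vcomp IHU IHW) _.
  by apply: ceq_sym; exact: interchange.
(* The squares for [A] and for [B] paste to one for the composite, whose remaining factor is
   rewritten by the induction hypothesis. *)
- apply: ceq_sym; apply: chi_times_unique.
  + via (cproj0 U W <|> (chi U A <|> chi U B)).
      by apply: square_hcomp (chi_times_proj0 _ _ _) (chi_times_proj0 _ _ _).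
    by apply: ceq_hcomp => //; exact: ceq_sym.
  + via (cproj1 U W <|> (chi W A <|> chi W B)).
      by apply: square_hcomp (chi_times_proj1 _ _ _) (chi_times_proj1 _ _ _).
    by apply: ceq_hcomp => //; exact: ceq_sym.
- apply: ceq_sym; apply: chi_plus_unique.
  + via ((chi U A <|> chi U B) <|> cinj0 U W); first exact: ceq_hcomp.
    by apply: square_hcomp (chi_plus_inj0 _ _ _) (chi_plus_inj0 _ _ _).
  + via ((chi W A <|> chi W B) <|> cinj1 U W); first exact: ceq_hcomp.
    by apply: square_hcomp (chi_plus_inj1 _ _ _) (chi_plus_inj1 _ _ _).
- apply: ceq_trans (ceq_iter_times IHU) _.
  by apply: ceq_sym; exact: iter_times_hcomp.
- apply: ceq_trans (ceq_iter_plus IHU) _.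
  by apply: ceq_sym; exact: iter_plus_hcomp.
Qed.

Lemma chi_unit U : chi U unit_ob ≡ hid U.
Proof.
elim: U => [D|D||U IHU W IHW|U IHU W IHW|U IHU W IHW|U IHU|U IHU].
- exact: chi_circ_unit.
- exact: chi_bullet_unit.
- by apply: ceq_sym; exact: hid_unit.
- apply: ceq_trans (ceq_vcomp IHU IHW) _.
  by apply: ceq_sym; exact: hid_tens.
(* An identity commutes with any projection by [square_hid]; the induction hypothesis turns the
   identity on the factor into its crossing. *)
- apply: ceq_sym; apply: chi_times_unique; apply: ceq_trans (square_hid _) _;
    by apply: ceq_hcomp => //; exact: ceq_sym.
- apply: ceq_sym; apply: chi_plus_unique; apply: ceq_trans (square_hid _);
    exact: ceq_hcomp.
- apply: ceq_trans (ceq_iter_times IHU) _.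
  by apply: ceq_sym; exact: iter_times_hid.
- apply: ceq_trans (ceq_iter_plus IHU) _.
  by apply: ceq_sym; exact: iter_plus_hid.
Qed.

End Strictification.

Theorem lemma20 (C : dmcat) (U : exch C) (A B : C) :
  (chi U (A ⊗ B)%obj ≡ chi U A <|> chi U B)%cell /\
  (chi U unit_ob ≡ hid U)%cell.
Proof. by split; [exact: chi_tens | exact: chi_unit]. Qed.
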